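(* Let $n$ be a positive integer and let $(p_{k,i})_{k\in\mathbb{Z},\,1\le i\le n_k}$ be the infinite configuration with $n_k=n$ for odd $k$ and $n_k=1$ for even $k$, determined by $$p_{0,1}=0,\qquad p_{1,j}=\sqrt{-1}+\cot\Bigl(\frac{j\pi}{n+1}\Bigr)\ (1\le j\le n),\qquad p_{k+2,i}=p_{k,i}+2\sqrt{-1}\ \text{ for all } k\in\mathbb{Z},\ 1\le i\le n_k.$$ For $r\in\mathbb{N}$ and $k$ even let $R^{(r)}_{k,1}(\theta)$, $\theta\in\mathbb{R}$, be the real-valued function attached to the neck $(k,1)$ (defined in the context), and let $R=\operatorname{Res}_0\bigl(\frac{\omega_1}{dz}\bigr)^{r+2}$. Then for all $r\in\mathbb{N}$ we have $R^{(r)}_{0,1}(\theta)\equiv 0$. In fact $R^{(r)}_{k,1}(\theta)\equiv 0$ for all even $k\in\mathbb{Z}$ (and all $r\in\mathbb{N}$). Moreover, $R$ is purely imaginary when $r$ is even, and $R$ is real when $r$ is odd.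
   Context: $\mathbb{N}$ denotes the positive integers. Put $c_k=1/n_k$. For each $k\in\mathbb{Z}$, $\omega_k$ is the meromorphic $1$-form on $\mathbb{C}$ whose coefficient function $\frac{\omega_k}{dz}$ is $$\frac{\omega_k}{dz}(z)=\sum_{i=1}^{n_{k-1}}\frac{c_{k-1}}{z-(p_{k-1,i}-p_{k-1,1})}-\sum_{i=1}^{n_k}\frac{c_k}{z-(p_{k,i}-p_{k-1,1})}.$$ For a meromorphic function $f$ and a point $q\in\mathbb{C}$, $\operatorname{Res}_q f$ denotes the coefficient of $(z-q)^{-1}$ in the Laurent expansion of $f$ at $q$; $\operatorname{Res}_q\bigl(\frac{\omega_k}{dz}\bigr)^{m}$ is the residue at $q$ of the $m$-th power of the function $\frac{\omega_k}{dz}$. For $k$ even, $r\in\mathbb{N}$ and $\theta\in\mathbb{R}$, $$R^{(r)}_{k,1}(\theta)=\operatorname{Im}\Bigl[e^{(r+1)\sqrt{-1}\,\theta}\,\operatorname{Res}_{p_{k,1}-p_{k-1,1}}\Bigl(\frac{\omega_k}{dz}\Bigr)^{r+2}-e^{-(r+1)\sqrt{-1}\,\theta}\,\overline{\operatorname{Res}_{0}\Bigl(\frac{\omega_{k+1}}{dz}\Bigr)^{r+2}}\Bigr].$$ The notation $\equiv 0$ means vanishing for all $\theta\in\mathbb{R}$. *)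

(* Defs.v *)
From Stdlib Require Export Reals ZArith Arith.
From Stdlib Require Import ClassicalEpsilon.
From Coquelicot Require Export Coquelicot.

Open Scope C_scope.

(** [a] is the family of coefficients of a Laurent expansion of [f] at [q] with
    finite principal part: [f z = sum_(m >= -N) a m * (z - q)^m] on a punctured
    disc around [q].  The identity is multiplied by [(z - q)^N], so that only
    natural powers of [z - q] occur. *)
Definition is_laurent (f : C -> C) (q : C) (a : Z -> C) : Prop :=
  exists (N : nat) (rho : R),
    (0 < rho)%R /\
    (forall m : Z, (m < - Z.of_nat N)%Z -> a m = 0) /\
    forall z : C, (0 < Cmod (z - q) < rho)%R ->
      is_pseries (K := C_AbsRing) (V := AbsRing_NormedModule C_AbsRing)
        (fun j : nat => a (Z.of_nat j - Z.of_nat N)%Z) (z - q)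
        ((z - q) ^ N * f z).

(** The value at a [q] where [f] is not meromorphic is unspecified.  Values of
    [f] at its poles (where Coquelicot's [/ 0] is a junk value) are irrelevant,
    since [is_laurent] only looks at a punctured disc. *)
Definition Res (f : C -> C) (q : C) : C :=
  epsilon (inhabits (RtoC 0))
    (fun c : C => exists a : Z -> C, is_laurent f q a /\ c = a (-1)%Z).

Definition cot (x : R) : R := (cos x / sin x)%R.

(** [e^(i t)] *)
Definition Cexpi (t : R) : C := (cos t, sin t).

(** A configuration is a pair [nk : Z -> nat], [p : Z -> nat -> C]; only the
    values [p k i] with [1 <= i <= nk k] are meaningful. *)

Definition c_ (nk : Z -> nat) (k : Z) : R := (1 / INR (nk k))%R.

(** The coefficient function of the 1-form [omega_k] with respect to [dz]. *)
Definition omega_dz (nk : Z -> nat) (p : Z -> nat -> C) (k : Z) (z : C) : C :=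
  sum_n_m (fun i : nat =>
      RtoC (c_ nk (k - 1)) / (z - (p (k - 1)%Z i - p (k - 1)%Z 1%nat)))
    1 (nk (k - 1)%Z)
  - sum_n_m (fun i : nat =>
      RtoC (c_ nk k) / (z - (p k i - p (k - 1)%Z 1%nat)))
    1 (nk k).

(** [R^(r)_(k,1)(theta)], by the formula valid for even [k]. *)
Definition Rneck (nk : Z -> nat) (p : Z -> nat -> C) (r : nat) (k : Z)
    (theta : R) : R :=
  Im (Cexpi (INR (r + 1) * theta)
        * Res (fun z => omega_dz nk p k z ^ (r + 2))
            (p k 1%nat - p (k - 1)%Z 1%nat)
      - Cexpi (- (INR (r + 1) * theta))
        * Cconj (Res (fun z => omega_dz nk p (k + 1) z ^ (r + 2)) 0)).

(* Main.v *)
Require Import Defs.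
From Stdlib Require Import Lia Lra ClassicalEpsilon.

(** Near every neck of an even level the configuration looks the same.  Write
    [f = neck_form n], that is
    [f w = 1/w - (1/n) * sum_j 1/(w - i - cot_j)] with
    [cot_j = cot (j * pi / (n+1))].  For even [k], [omega_(k+1)/dz] is [f]
    itself.  The nodes [cot_j] are permuted by negation (replace [j] by
    [n + 1 - j]), whence [omega_k/dz] is [w |-> f (q - w)], where [q] is the
    point at which its residue is taken: [neck_form_opp].

    A point reflection changes the sign of a residue, so the residue of
    [(omega_k/dz)^(r+2)] at [q] is [- R], with [R] the residue of [f^(r+2)] at
    [0].  Then, with [E = e^(i (r+1) theta)], the neck function is
    [Im (- E R - conj (E R))], the imaginary part of a real number.

    Because the nodes are real, the same sum also gives
    [conj (f (conj w)) = - f (- w)].  Raising this to the power [r+2] and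
    comparing the coefficients of [1/w] gives [conj R = - (-1)^r R], which is
    the statement on the parity of [r].

    As [Res] chooses a value that is a coefficient of some Laurent expansion,
    these comparisons need both uniqueness and existence of expansions.
    Uniqueness ([is_laurent_unique]) is reduced to real power series by
    restricting the variable to the real axis and taking real and imaginary
    parts of the coefficients.  Existence ([meromorphic_simple_pole_pow]) uses a
    class of germs with geometrically bounded coefficients which is stable under
    division by [z - b] with [b <> 0]: expanding one factor at a time, the power
    [(z f)^m] is obtained by such divisions, multiplications by [z] and sums. *)

(** * Uniqueness of complex power series *)

Notation is_Cpseries :=
  (is_pseries (K := C_AbsRing) (V := AbsRing_NormedModule C_AbsRing)).

Lemma is_Cpseries_iff (a : nat -> C) (z l : C) :
  is_Cpseries a z l <->
  forall eps : posreal, exists N : nat, forall m : nat, (N <= m)%nat ->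
    (Cmod (sum_n (fun k => z ^ k * a k) m - l)%C < eps)%R.
Proof.
  assert (E : forall m, sum_n (G := AbsRing_NormedModule C_AbsRing)
      (fun k => scal (pow_n (K := C_AbsRing) z k) (a k)) m
      = sum_n (fun k => z ^ k * a k) m).
  { intro m; apply sum_n_ext; intro k.
    change (Cmult (pow_n (K := C_AbsRing) z k) (a k) = z ^ k * a k). f_equal. }
  split.
  - intros H eps. destruct (proj1 (filterlim_locally _ _) H eps) as [N HN].
    exists N; intros m Hm. rewrite <- E. exact (HN m Hm).
  - intros H. apply (proj2 (filterlim_locally _ _)). intro eps. destruct (H eps) as [N HN].
    exists N; intros m Hm. generalize (HN m Hm). rewrite <- E. exact (fun h => h).
Qed.

(** On the real axis the real and imaginary parts of a complex power series are
    real power series; [L] stands for either. *)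
Lemma is_pseries_R_of_C (L : C -> R) (a : nat -> C) (x : R) (l : C) :
  (forall u v, L (u + v)%C = (L u + L v)%R) ->
  (forall (t : R) u, L (t * u)%C = (t * L u)%R) ->
  (forall u, (Rabs (L u) <= Cmod u)%R) ->
  is_Cpseries a (RtoC x) l -> is_pseries (fun k => L (a k)) x (L l).
Proof.
  intros Hp Hs Hb H. rewrite is_Cpseries_iff in H.
  apply is_pseries_R. apply (proj2 (filterlim_locally _ _)). intro eps.
  destruct (H eps) as [N HN]. exists N; intros m Hm.
  assert (E : forall m, L (sum_n (fun k => RtoC x ^ k * a k)%C m)
                = sum_n (fun k => L (a k) * x ^ k)%R m).
  { intro j. induction j as [|j IH].
    - rewrite !sum_O. rewrite <- RtoC_pow, Hs. simpl; ring.
    - rewrite !sum_Sn, <- IH. etransitivity; [apply Hp|].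
      rewrite <- RtoC_pow, Hs. unfold plus; simpl; ring. }
  change (Rabs (sum_n (fun k => L (a k) * x ^ k)%R m - L l) < eps)%R.
  rewrite <- E.
  replace (L (sum_n (fun k => RtoC x ^ k * a k)%C m) - L l)%R
    with (L (sum_n (fun k => RtoC x ^ k * a k)%C m - l)%C).
  { eapply Rle_lt_trans; [apply Hb | now apply HN]. }
  unfold Cminus. rewrite Hp.
  replace (- l) with (RtoC (-1) * l) by (apply injective_projections; simpl; ring).
  rewrite Hs. ring.
Qed.

Lemma CV_radius_pos_of_pseries (a : nat -> R) (x l : R) :
  (0 < x)%R -> is_pseries a x l -> Rbar_lt 0 (CV_radius a).
Proof.
  intros Hx H. apply Rbar_not_le_lt. intro Hle.
  apply (CV_disk_outside a x).
  - eapply Rbar_le_lt_trans; [exact Hle|]. simpl. rewrite Rabs_pos_eq; lra.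
  - apply ex_series_lim_0. exists l. now apply is_pseries_R.
Qed.

(** Nothing is assumed about the sum at [0], so both series are multiplied by
    [x]: the sums then vanish at [0] and agree on a full neighbourhood, where
    the coefficients are the derivatives at [0]. *)
Lemma pseries_R_unique (a b : nat -> R) (h : R -> R) (rho : R) :
  (0 < rho)%R ->
  (forall x, (0 < Rabs x < rho)%R -> is_pseries a x (h x)) ->
  (forall x, (0 < Rabs x < rho)%R -> is_pseries b x (h x)) ->
  forall k, a k = b k.
Proof.
  intros Hrho Ha Hb k.
  change (PS_incr_1 (K := R_AbsRing) (V := R_NormedModule) a (S k)
    = PS_incr_1 (K := R_AbsRing) (V := R_NormedModule) b (S k)).
  assert (Hpos : (0 < Rabs (rho / 2) < rho)%R) by (rewrite Rabs_pos_eq; lra).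
  apply PSeries_ext_recip.
  - apply CV_radius_pos_of_pseries with (rho / 2)%R (scal (rho / 2)%R (h (rho / 2)%R)); [lra|].
    apply (is_pseries_incr_1 (K := R_AbsRing) (V := R_NormedModule)). now apply Ha.
  - apply CV_radius_pos_of_pseries with (rho / 2)%R (scal (rho / 2)%R (h (rho / 2)%R)); [lra|].
    apply (is_pseries_incr_1 (K := R_AbsRing) (V := R_NormedModule)). now apply Hb.
  - exists (mkposreal rho Hrho). intros x Hx.
    assert (Hx' : (Rabs x < rho)%R).
    { change (Rabs (x - 0) < rho)%R in Hx. now rewrite Rminus_0_r in Hx. }
    destruct (Req_dec x 0) as [->|Hx0].
    + now rewrite !PSeries_0.
    + assert (0 < Rabs x)%R by now apply Rabs_pos_lt.
      transitivity (scal x (h x)); [|symmetry];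
        apply is_pseries_unique, (is_pseries_incr_1 (K := R_AbsRing) (V := R_NormedModule)); auto.
Qed.

Lemma Im_le_Cmod (u : C) : (Rabs (Im u) <= Cmod u)%R.
Proof. eapply Rle_trans; [|apply Rmax_Cmod]. apply Rmax_r. Qed.

Lemma Cpseries_unique (a b : nat -> C) (h : C -> C) (rho : R) :
  (0 < rho)%R ->
  (forall z, (0 < Cmod z < rho)%R -> is_Cpseries a z (h z)) ->
  (forall z, (0 < Cmod z < rho)%R -> is_Cpseries b z (h z)) ->
  forall k, a k = b k.
Proof.
  intros Hrho Ha Hb k.
  assert (HL : forall L : C -> R,
    (forall u v, L (u + v)%C = (L u + L v)%R) ->
    (forall (t : R) u, L (t * u)%C = (t * L u)%R) ->
    (forall u, (Rabs (L u) <= Cmod u)%R) -> L (a k) = L (b k)).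
  { intros L H1 H2 H3.
    apply (pseries_R_unique (fun j => L (a j)) (fun j => L (b j))
             (fun x => L (h (RtoC x))) rho Hrho);
    intros x Hx; rewrite <- Cmod_R in Hx; apply is_pseries_R_of_C; auto. }
  rewrite (surjective_pairing (a k)), (surjective_pairing (b k)). f_equal.
  - apply (HL Re); [reflexivity | | apply re_le_Cmod].
    intros t u; unfold Re; simpl; ring.
  - apply (HL Im); [reflexivity | | apply Im_le_Cmod].
    intros t u; unfold Im; simpl; ring.
Qed.

(** * Laurent expansions and residues *)

(** Makes the pole orders of two expansions equal before they are compared. *)
Lemma laurent_raise (f : C -> C) (q : C) (a : Z -> C) (N d : nat) (rho : R) :
    (forall m : Z, (m < - Z.of_nat N)%Z -> a m = 0) ->
    (forall z : C, (0 < Cmod (z - q)%C < rho)%R ->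
      is_Cpseries (fun j : nat => a (Z.of_nat j - Z.of_nat N)%Z) (z - q)
        ((z - q) ^ N * f z)) ->
    (forall z : C, (0 < Cmod (z - q)%C < rho)%R ->
      is_Cpseries (fun j : nat => a (Z.of_nat j - Z.of_nat (N + d))%Z) (z - q)
        ((z - q) ^ (N + d) * f z)).
Proof.
  intros H0 H z Hz.
  replace ((z - q) ^ (N + d) * f z) with
    (scal (pow_n (K := C_AbsRing) (z - q) d) ((z - q) ^ N * f z)).
  2:{ rewrite Cpow_add_r.
      change ((z - q) ^ d * ((z - q) ^ N * f z) = (z - q) ^ N * (z - q) ^ d * f z).
      ring. }
  eapply is_pseries_ext;
    [|exact (is_pseries_incr_n (K := C_AbsRing) (V := AbsRing_NormedModule C_AbsRing)
               _ d _ _ (H z Hz))].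
  intro j. rewrite PS_incr_n_simplify. destruct (le_lt_dec d j).
  - f_equal. lia.
  - symmetry. apply H0. lia.
Qed.

Lemma is_laurent_unique (f : C -> C) (q : C) (a b : Z -> C) :
  is_laurent f q a -> is_laurent f q b -> forall m, a m = b m.
Proof.
  intros (N & rho & Hrho & Ha0 & Ha) (M & sig & Hsig & Hb0 & Hb) m.
  destruct (Z_lt_le_dec m (- Z.of_nat (N + M))) as [Hm|Hm].
  { rewrite Ha0, Hb0 by lia. reflexivity. }
  replace m with (Z.of_nat (Z.to_nat (m + Z.of_nat (N + M))) - Z.of_nat (N + M))%Z by lia.
  set (tau := Rmin rho sig).
  apply (Cpseries_unique
    (fun j => a (Z.of_nat j - Z.of_nat (N + M))%Z)
    (fun j => b (Z.of_nat j - Z.of_nat (N + M))%Z)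
    (fun w => w ^ (N + M) * f (w + q)) tau).
  - now apply Rmin_glb_lt.
  - intros w Hw. pose proof (laurent_raise f q a N M rho Ha0 Ha (w + q)) as E.
    replace (w + q - q) with w in E by ring. apply E.
    unfold tau in Hw. pose proof (Rmin_l rho sig). lra.
  - intros w Hw. pose proof (laurent_raise f q b M N sig Hb0 Hb (w + q)) as E.
    replace (w + q - q) with w in E by ring. rewrite (Nat.add_comm M N) in E. apply E.
    unfold tau in Hw. pose proof (Rmin_r rho sig). lra.
Qed.

Lemma Res_laurent (f : C -> C) (q : C) (a : Z -> C) :
  is_laurent f q a -> Res f q = a (-1)%Z.
Proof.
  intro H. unfold Res.
  destruct (epsilon_spec (inhabits (RtoC 0))
    (fun c : C => exists a : Z -> C, is_laurent f q a /\ c = a (-1)%Z)) as (b & Hb & ->).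
  - now exists (a (-1)%Z), a.
  - exact (is_laurent_unique f q b a Hb H _).
Qed.

(** * Behaviour of residues under symmetries *)

Definition meromorphic_at (f : C -> C) (q : C) : Prop :=
  exists a : Z -> C, is_laurent f q a.

Lemma is_laurent_ext (f g : C -> C) (q : C) (a : Z -> C) :
  (forall z, f z = g z) -> is_laurent f q a -> is_laurent g q a.
Proof.
  intros E (N & rho & Hrho & H0 & H).
  exists N, rho; repeat split; auto. intros z Hz. rewrite <- E. auto.
Qed.

Lemma is_laurent_scal (f : C -> C) (q c : C) (a : Z -> C) :
  is_laurent f q a -> is_laurent (fun z => c * f z) q (fun m => c * a m).
Proof.
  intros (N & rho & Hrho & H0 & H). exists N, rho; repeat split; auto.
  - intros m Hm. rewrite (H0 m Hm). ring.
  - intros z Hz.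
    replace ((z - q) ^ N * (c * f z)) with (c * ((z - q) ^ N * f z)) by ring.
    exact (is_pseries_scal (K := C_AbsRing) (V := AbsRing_NormedModule C_AbsRing) c _ _ _
             (Cmult_comm _ _) (H z Hz)).
Qed.

Lemma Cpow_m1_even (k : nat) : Nat.Even k -> (RtoC (-1)) ^ k = 1.
Proof.
  intros [j ->]. rewrite Cpow_mult_r. replace (RtoC (-1) ^ 2) with (RtoC 1); [apply Cpow_1_l|].
  apply injective_projections; simpl; ring.
Qed.

Lemma Cpow_m1_odd (k : nat) : Nat.Odd k -> (RtoC (-1)) ^ k = -1.
Proof.
  intros [j ->]. rewrite Cpow_add_r, Cpow_m1_even by (now exists j).
  apply injective_projections; simpl; ring.
Qed.

(** The change of variable [z |-> q + q' - z] exchanges [q] and [q'] and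
    multiplies the local coordinate by [-1].  The sign of the coefficient of
    index [m] is written with [Z.abs_nat m], which has the parity of [m]. *)
Lemma is_laurent_reflect (f : C -> C) (q q' : C) (a : Z -> C) :
  is_laurent f q a ->
  is_laurent (fun z => f (q + q' - z)) q' (fun m => (RtoC (-1)) ^ (Z.abs_nat m) * a m).
Proof.
  intros (N & rho & Hrho & H0 & H). exists N, rho; repeat split; auto.
  - intros m Hm. rewrite (H0 m Hm). ring.
  - intros z Hz.
    assert (Ew : q + q' - z - q = RtoC (-1) * (z - q'))
      by (apply injective_projections; simpl; ring).
    assert (Hw : (0 < Cmod (q + q' - z - q)%C < rho)%R).
    { rewrite Ew, Cmod_mult, Cmod_R, Rabs_left by lra. lra. }
    specialize (H _ Hw).
    apply (is_pseries_scal (K := C_AbsRing) (V := AbsRing_NormedModule C_AbsRing)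
      (RtoC (-1) ^ N) _ _ _ (Cmult_comm _ _)) in H.
    replace ((z - q') ^ N * f (q + q' - z)) with
      (RtoC (-1) ^ N * ((q + q' - z - q) ^ N * f (q + q' - z))).
    2:{ rewrite Ew, Cpow_mult_l, !Cmult_assoc, <- Cpow_add_r, Cpow_m1_even; [ring|].
        exists N; lia. }
    revert H. apply is_series_ext. intro j.
    change ((q + q' - z - q) ^ j * (RtoC (-1) ^ N * a (Z.of_nat j - Z.of_nat N)%Z) =
      (z - q') ^ j * (RtoC (-1) ^ Z.abs_nat (Z.of_nat j - Z.of_nat N)
        * a (Z.of_nat j - Z.of_nat N)%Z)).
    rewrite Ew, Cpow_mult_l.
    replace (RtoC (-1) ^ Z.abs_nat (Z.of_nat j - Z.of_nat N)) with (RtoC (-1) ^ (j + N)).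
    { rewrite Cpow_add_r. ring. }
    (* [j + N] and [j - N] differ by an even number *)
    assert (Ej : (j + N = Z.abs_nat (Z.of_nat j - Z.of_nat N) + 2 * Nat.min j N)%nat) by lia.
    rewrite Ej, Cpow_add_r, (Cpow_m1_even (2 * _)) by (now eexists). ring.
Qed.

Lemma Res_reflect (f : C -> C) (q q' : C) :
  meromorphic_at f q -> Res (fun z => f (q + q' - z)) q' = - Res f q.
Proof.
  intros [a Ha].
  rewrite (Res_laurent _ _ _ Ha), (Res_laurent _ _ _ (is_laurent_reflect f q q' a Ha)).
  apply injective_projections; simpl; ring.
Qed.

Lemma is_Cpseries_conj (a : nat -> C) (z l : C) :
  is_Cpseries a z l -> is_Cpseries (fun k => Cconj (a k)) (Cconj z) (Cconj l).
Proof.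
  rewrite !is_Cpseries_iff. intros H eps. destruct (H eps) as [N HN].
  exists N; intros m Hm.
  replace (sum_n (fun k => Cconj z ^ k * Cconj (a k)) m)
    with (Cconj (sum_n (fun k => z ^ k * a k) m)).
  { rewrite <- Cminus_conj, Cmod_conj. now apply HN. }
  clear HN Hm. induction m as [|m IH].
  - rewrite !sum_O. now rewrite Cmult_conj, Cpow_conj.
  - rewrite !sum_Sn, <- IH, <- Cpow_conj, <- Cmult_conj. apply Cplus_conj.
Qed.

Lemma is_laurent_conj (f : C -> C) (q : C) (a : Z -> C) :
  is_laurent f q a ->
  is_laurent (fun z => Cconj (f (Cconj z))) (Cconj q) (fun m => Cconj (a m)).
Proof.
  intros (N & rho & Hrho & H0 & H). exists N, rho; repeat split; auto.
  - intros m Hm. rewrite (H0 m Hm). apply injective_projections; simpl; ring.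
  - intros z Hz.
    assert (Ew : z - Cconj q = Cconj (Cconj z - q)) by now rewrite Cminus_conj, Cconj_conj.
    rewrite Ew, <- Cpow_conj, <- Cmult_conj.
    apply (is_Cpseries_conj (fun j => a (Z.of_nat j - Z.of_nat N)%Z)). apply H.
    now rewrite Ew, Cmod_conj in Hz.
Qed.

(** * Existence of Laurent expansions *)

(** The geometric bound makes explicit a disc on which the series of a quotient
    converges. *)
Definition analytic_at_0 (h : C -> C) : Prop :=
  exists (a : nat -> C) (M K : R),
    (0 < K)%R /\ (forall k, (Cmod (a k) <= M * K ^ k)%R) /\
    forall z : C, (K * Cmod z < 1)%R -> is_Cpseries a z (h z).

Lemma geom_bound_mono (a : nat -> C) (M K K' : R) :
  (0 < K)%R -> (K <= K')%R -> (forall k, (Cmod (a k) <= M * K ^ k)%R) ->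
  forall k, (Cmod (a k) <= M * K' ^ k)%R.
Proof.
  intros H0 HK H k. eapply Rle_trans; [apply H|].
  apply Rmult_le_compat_l.
  - pose proof (H 0%nat). pose proof (Cmod_ge_0 (a 0%nat)). simpl in *. lra.
  - apply pow_incr; lra.
Qed.

Lemma analytic_at_0_plus (f g : C -> C) :
  analytic_at_0 f -> analytic_at_0 g -> analytic_at_0 (fun z => f z + g z).
Proof.
  intros (a & M & K & HK & Ba & Ha) (b & M' & K' & HK' & Bb & Hb).
  exists (fun k => a k + b k), (M + M')%R, (Rmax K K').
  pose proof (Rmax_l K K'). pose proof (Rmax_r K K').
  repeat split.
  - lra.
  - intro k. eapply Rle_trans; [apply Cmod_triangle|]. rewrite Rmult_plus_distr_r.
    apply Rplus_le_compat.
    + now apply (geom_bound_mono a M K).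
    + now apply (geom_bound_mono b M' K').
  - intros z Hz. pose proof (Cmod_ge_0 z).
    apply (is_pseries_plus (K := C_AbsRing) (V := AbsRing_NormedModule C_AbsRing));
      [apply Ha | apply Hb]; nra.
Qed.

Lemma analytic_at_0_scal (c : C) (f : C -> C) :
  analytic_at_0 f -> analytic_at_0 (fun z => c * f z).
Proof.
  intros (a & M & K & HK & Ba & Ha).
  exists (fun k => c * a k), (Cmod c * M)%R, K. repeat split; auto.
  - intro k. rewrite Cmod_mult, Rmult_assoc. apply Rmult_le_compat_l; [apply Cmod_ge_0|auto].
  - intros z Hz.
    exact (is_pseries_scal (K := C_AbsRing) (V := AbsRing_NormedModule C_AbsRing) c _ _ _
             (Cmult_comm _ _) (Ha z Hz)).
Qed.

Lemma analytic_at_0_mult_z (f : C -> C) :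
  analytic_at_0 f -> analytic_at_0 (fun z => z * f z).
Proof.
  intros (a & M & K & HK & Ba & Ha).
  exists (fun k => match k with O => RtoC 0 | S j => a j end), (M / K)%R, K. repeat split; auto.
  - intros [|k].
    + rewrite Cmod_0. pose proof (Ba 0%nat). pose proof (Cmod_ge_0 (a 0%nat)). simpl in *.
      apply Rmult_le_pos; [|lra]. apply Rle_div_r; lra.
    + eapply Rle_trans; [apply Ba|]. simpl. apply Req_le. field. lra.
  - intros z Hz.
    refine (is_pseries_ext _ _ _ _ _ (is_pseries_incr_1 (K := C_AbsRing)
      (V := AbsRing_NormedModule C_AbsRing) _ _ _ (Ha z Hz))).
    now intros [|k].
Qed.

Lemma analytic_at_0_const (c : C) : analytic_at_0 (fun _ => c).
Proof.
  exists (fun k => match k with O => c | S _ => RtoC 0 end), (Cmod c), 1%R. repeat split.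
  - lra.
  - intro k. rewrite pow1, Rmult_1_r. destruct k; [lra|]. rewrite Cmod_0. apply Cmod_ge_0.
  - intros z _. apply is_Cpseries_iff. intro eps. exists 0%nat; intros m _.
    replace (sum_n _ m) with c.
    { replace (c - c) with (RtoC 0) by ring. rewrite Cmod_0. apply cond_pos. }
    induction m as [|m IH].
    + rewrite sum_O. simpl. ring.
    + rewrite sum_Sn, <- IH. change (c = c + z ^ S m * 0). ring.
Qed.

Lemma analytic_at_0_ext (f g : C -> C) :
  (forall z, f z = g z) -> analytic_at_0 f -> analytic_at_0 g.
Proof.
  intros E (a & M & K & HK & Ba & Ha).
  exists a, M, K. repeat split; auto. intros z Hz. rewrite <- E. auto.
Qed.

Lemma analytic_at_0_sum (f : nat -> C -> C) (n : nat) :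
  (forall i, (1 <= i <= n)%nat -> analytic_at_0 (f i)) ->
  analytic_at_0 (fun z => sum_n_m (fun i => f i z) 1 n).
Proof.
  induction n as [|n IH]; intro H.
  - apply analytic_at_0_ext with (fun _ => RtoC 0); [|apply analytic_at_0_const].
    intro z. now rewrite sum_n_m_zero by lia.
  - apply analytic_at_0_ext with (fun z => sum_n_m (fun i => f i z) 1 n + f (S n) z).
    { intro z. now rewrite sum_n_Sm by lia. }
    apply analytic_at_0_plus; [apply IH; intros i Hi|]; apply H; lia.
Qed.

(** Coefficients of [f z / (z - b)] when [a] are those of [f], obtained by
    comparing coefficients in [(z - b) * g z = f z]. *)
Fixpoint quot_coef (a : nat -> C) (b : C) (k : nat) : C :=
  match k with
  | O => - a O / b
  | S j => (quot_coef a b j - a (S j)) / b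
  end.

(** With [K >= 2 / |b|] the division by [b] in the recurrence absorbs the
    previous term with a factor [1/2], and the new coefficient of the dividend
    fills the other half of the bound. *)
Lemma quot_coef_bound (a : nat -> C) (b : C) (M K : R) :
  b <> 0 -> (0 < K)%R -> (2 / Cmod b <= K)%R ->
  (forall k, (Cmod (a k) <= M * K ^ k)%R) ->
  forall k, (Cmod (quot_coef a b k) <= 2 * M / Cmod b * K ^ k)%R.
Proof.
  intros Hb HK HbK Ba k.
  assert (Hb0 : (0 < Cmod b)%R) by now apply Cmod_gt_0.
  assert (HM : (0 <= M)%R).
  { pose proof (Ba 0%nat). pose proof (Cmod_ge_0 (a 0%nat)). simpl in *. lra. }
  assert (Hi : (0 < / Cmod b)%R) by now apply Rinv_0_lt_compat.
  unfold Rdiv in *. induction k as [|k IH]; simpl quot_coef.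
  - rewrite Cmod_div, Cmod_opp by auto. pose proof (Ba 0%nat) as H. simpl in *.
    unfold Rdiv. pose proof (Cmod_ge_0 (a 0%nat)). nra.
  - rewrite Cmod_div by auto.
    assert (H : (Cmod (quot_coef a b k - a (S k))%C
                 <= 2 * M * / Cmod b * K ^ k + M * K ^ S k)%R).
    { eapply Rle_trans; [apply Cmod_triangle|]. rewrite Cmod_opp.
      apply Rplus_le_compat; auto. }
    unfold Rdiv. eapply Rle_trans.
    { apply Rmult_le_compat_r; [lra | exact H]. }
    assert (Hk : (0 < K ^ k)%R) by now apply pow_lt.
    simpl.
    assert (2 * / Cmod b * (M * / Cmod b * K ^ k) <= K * (M * / Cmod b * K ^ k))%R.
    { apply Rmult_le_compat_r; auto. repeat apply Rmult_le_pos; lra. }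
    lra.
Qed.

(** The partial sums telescope: convergence of the quotient series reduces to that
    of the series of the dividend and to the vanishing of one remainder term. *)
Lemma quot_coef_sum (a : nat -> C) (b z : C) (m : nat) :
  b <> 0 ->
  (z - b) * sum_n (fun k => z ^ k * quot_coef a b k) m
  = sum_n (fun k => z ^ k * a k) m + quot_coef a b m * z ^ S m.
Proof.
  intros Hb. induction m as [|m IH].
  - rewrite !sum_O. simpl. field. auto.
  - rewrite !sum_Sn.
    change ((z - b) * (sum_n (fun k => z ^ k * quot_coef a b k) m + z ^ S m * quot_coef a b (S m))
     = sum_n (fun k => z ^ k * a k) m + z ^ S m * a (S m) + quot_coef a b (S m) * z ^ S (S m)).
    rewrite Cmult_plus_distr_l, IH. simpl quot_coef.
    rewrite (Cpow_S z (S m)). field. auto.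
Qed.

Lemma analytic_at_0_div_linear (f : C -> C) (b : C) :
  b <> 0 -> analytic_at_0 f -> analytic_at_0 (fun z => f z / (z - b)).
Proof.
  intros Hb (a & M & K0 & HK0 & Ba0 & Ha).
  set (K := Rmax K0 (2 / Cmod b)).
  assert (Hb0 : (0 < Cmod b)%R) by now apply Cmod_gt_0.
  assert (HK1 : (K0 <= K)%R) by apply Rmax_l.
  assert (HK2 : (2 / Cmod b <= K)%R) by apply Rmax_r.
  assert (Ba := geom_bound_mono a M K0 K HK0 HK1 Ba0).
  assert (HK : (0 < K)%R) by lra.
  assert (Bc := quot_coef_bound a b M K Hb HK HK2 Ba).
  set (M' := (2 * M / Cmod b)%R) in Bc.
  exists (quot_coef a b), M', K. repeat split; [lra | exact Bc |].
  intros z Hz. pose proof (Cmod_ge_0 z) as Hz0.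
  assert (Hzb : z - b <> 0).
  { intro E. replace z with b in Hz by (rewrite <- (Cplus_0_r b), <- E; ring).
    apply (Rmult_le_compat_r (Cmod b)) in HK2; [|lra].
    replace (2 / Cmod b * Cmod b)%R with 2%R in HK2 by (field; lra). lra. }
  assert (Hd : (0 < Cmod (z - b)%C)%R) by now apply Cmod_gt_0.
  apply is_Cpseries_iff. intro eps.
  assert (He : (0 < eps * Cmod (z - b)%C / 2)%R).
  { pose proof (cond_pos eps). apply Rdiv_lt_0_compat; [nra|lra]. }
  destruct (proj1 (is_Cpseries_iff _ _ _) (Ha z ltac:(nra)) (mkposreal _ He)) as [N1 H1].
  assert (HL : is_lim_seq (fun k => (M' * Cmod z * (K * Cmod z) ^ k)%R) 0).
  { replace (Finite 0) with (Rbar_mult (M' * Cmod z)%R 0) by (simpl; f_equal; ring).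
    apply is_lim_seq_scal_l, is_lim_seq_geom. rewrite Rabs_pos_eq; nra. }
  destruct (proj2 (is_lim_seq_spec _ _) HL (mkposreal _ He)) as [N2 H2].
  exists (Nat.max N1 N2). intros m Hm.
  specialize (H1 m ltac:(lia)). specialize (H2 m ltac:(lia)). simpl in H1, H2.
  replace (sum_n (fun k => z ^ k * quot_coef a b k) m - f z / (z - b)) with
    ((sum_n (fun k => z ^ k * a k) m - f z + quot_coef a b m * z ^ S m) / (z - b)).
  2:{ replace (sum_n (fun k => z ^ k * quot_coef a b k) m) with
       ((z - b) * sum_n (fun k => z ^ k * quot_coef a b k) m / (z - b)) by (field; auto).
      rewrite quot_coef_sum by auto. field. auto. }
  rewrite Cmod_div by auto. apply Rlt_div_l; [lra|].
  eapply Rle_lt_trans; [apply Cmod_triangle|].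
  assert (H3 : (Cmod (quot_coef a b m * z ^ S m)%C <= M' * Cmod z * (K * Cmod z) ^ m)%R).
  { rewrite Cmod_mult, Cmod_pow, Rpow_mult_distr. simpl.
    pose proof (Bc m). assert (0 <= Cmod z * Cmod z ^ m)%R.
    { apply Rmult_le_pos; [|apply pow_le]; lra. }
    apply Rle_trans with (M' * K ^ m * (Cmod z * Cmod z ^ m))%R; [|lra].
    now apply Rmult_le_compat_r. }
  rewrite Rminus_0_r in H2. apply Rabs_def2 in H2. lra.
Qed.

Lemma meromorphic_at_0_of_analytic (f h : C -> C) (N : nat) :
  analytic_at_0 h -> (forall z : C, z <> 0 -> z ^ N * f z = h z) -> meromorphic_at f 0.
Proof.
  intros (a & M & K & HK & Ba & Ha) E.
  exists (fun m => if (m <? - Z.of_nat N)%Z then RtoC 0 else a (Z.to_nat (m + Z.of_nat N))).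
  exists N, (/ K)%R. repeat split.
  - now apply Rinv_0_lt_compat.
  - intros m Hm. apply Z.ltb_lt in Hm. now rewrite Hm.
  - intros z [Hz1 Hz2]. replace (z - 0) with z in * by ring.
    rewrite (E z) by now apply Cmod_gt_0.
    apply (is_pseries_ext (K := C_AbsRing) (V := AbsRing_NormedModule C_AbsRing) a).
    + intro j. destruct (Z.ltb_spec (Z.of_nat j - Z.of_nat N) (- Z.of_nat N)); [lia|].
      f_equal. lia.
    + apply Ha. apply (Rmult_lt_compat_l K) in Hz2; [|auto].
      now rewrite Rinv_r in Hz2 by lra.
Qed.

(** After multiplication by [z^m] the function is the [m]-th power of
    [1 - z * sum_i c / (z - b i)].  One factor at a time is distributed over the
    sum, so that only divisions by [z - b i] are used. *)
Lemma meromorphic_simple_pole_pow (c : C) (b : nat -> C) (n m : nat) :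
  (forall i, (1 <= i <= n)%nat -> b i <> 0) ->
  meromorphic_at (fun z => (/ z - sum_n_m (fun i => c / (z - b i)) 1 n) ^ m) 0.
Proof.
  intros Hb.
  set (S z := sum_n_m (fun i => c / (z - b i)) 1 n).
  apply (meromorphic_at_0_of_analytic _ (fun z => (1 - z * S z) ^ m) m).
  2:{ intros z Hz. rewrite <- Cpow_mult_l. f_equal. unfold S. field. auto. }
  induction m as [|m IH]; [apply (analytic_at_0_const 1)|].
  apply analytic_at_0_ext with (fun z => (1 - z * S z) ^ m
     + (-1) * (z * sum_n_m (fun i => c * ((1 - z * S z) ^ m / (z - b i))) 1 n)).
  2:{ apply analytic_at_0_plus; [exact IH|].
    apply analytic_at_0_scal, analytic_at_0_mult_z.
    apply (analytic_at_0_sum (fun i z => c * ((1 - z * S z) ^ m / (z - b i)))).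
    intros i Hi. apply analytic_at_0_scal, analytic_at_0_div_linear; auto. }
  intro z. rewrite Cpow_S.
  rewrite (sum_n_m_ext _ (fun i => mult (K := C_Ring) ((1 - z * S z) ^ m) (c / (z - b i)))).
  2:{ intro i. change (c * ((1 - z * S z) ^ m / (z - b i)) = (1 - z * S z) ^ m * (c / (z - b i))).
      unfold Cdiv. ring. }
  pose proof (sum_n_m_mult_l (K := C_Ring) ((1 - z * S z) ^ m) (fun i => c / (z - b i)) 1 n) as E.
  change ((1 - z * S z) ^ m + -1 * (z * sum_n_m (G := C_Ring)
      (fun i => mult (K := C_Ring) ((1 - z * S z) ^ m) (c / (z - b i))) 1 n)
    = (1 - z * S z) * (1 - z * S z) ^ m).
  rewrite E.
  change ((1 - z * S z) ^ m + -1 * (z * ((1 - z * S z) ^ m * S z))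
    = (1 - z * S z) * (1 - z * S z) ^ m).
  apply injective_projections; simpl; ring.
Qed.

(** * The symmetries of the neck form *)

(** Valid at [0] as well, since [/ 0] is [0]; hence the symmetries below hold for
    all [z], including the poles. *)
Lemma Cinv_opp (z : C) : / (- z) = - / z.
Proof.
  unfold Cinv, Copp; simpl.
  replace (- fst z * (- fst z * 1) + - snd z * (- snd z * 1))%R
    with (fst z * (fst z * 1) + snd z * (snd z * 1))%R by ring.
  apply injective_projections; simpl; unfold Rdiv; ring.
Qed.

Lemma Cinv_conj_total (z : C) : / Cconj z = Cconj (/ z).
Proof.
  unfold Cinv, Cconj; simpl.
  replace (- snd z * (- snd z * 1))%R with (snd z * (snd z * 1))%R by ring.
  apply injective_projections; simpl; unfold Rdiv; ring.
Qed.

Lemma sum_n_m_rev (u : nat -> C) (n : nat) :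
  sum_n_m u 1 n = sum_n_m (fun i => u (n + 1 - i)%nat) 1 n.
Proof.
  revert u. induction n as [|n IH]; intro u.
  - now rewrite !sum_n_m_zero by lia.
  - rewrite sum_Sn_m, <- sum_n_m_S, IH by lia. rewrite (sum_n_Sm _ 1 n) by lia.
    replace (S n + 1 - S n)%nat with 1%nat by lia. rewrite plus_comm. f_equal.
    apply sum_n_m_ext_loc. intros k Hk. f_equal. lia.
Qed.

Lemma sum_n_m_conj (u : nat -> C) (n : nat) :
  Cconj (sum_n_m u 1 n) = sum_n_m (fun i => Cconj (u i)) 1 n.
Proof.
  induction n as [|n IH].
  - rewrite !sum_n_m_zero by lia. apply injective_projections; simpl; ring.
  - rewrite !sum_n_Sm, <- IH by lia. apply Cplus_conj.
Qed.

Lemma sum_n_m_opp (u : nat -> C) (n : nat) :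
  sum_n_m (fun i => - u i) 1 n = - sum_n_m u 1 n.
Proof.
  induction n as [|n IH].
  - rewrite !sum_n_m_zero by lia. apply injective_projections; simpl; ring.
  - rewrite !sum_n_Sm, IH by lia. apply injective_projections; simpl; ring.
Qed.

(** Iterated sums have the carrier of an abelian monoid as their type; [ring]
    recognises an equation only when it is stated in [C]. *)
Local Ltac eq_in_C := match goal with |- @eq _ ?a ?b => change (@eq C a b) end.

Definition cot_node (n j : nat) : R := cot (INR j * PI / INR (n + 1)).

Lemma cot_node_rev (n j : nat) :
  (1 <= j <= n)%nat -> cot_node n (n + 1 - j) = (- cot_node n j)%R.
Proof.
  intro Hj. unfold cot_node, cot. rewrite minus_INR by lia.
  assert (INR (n + 1) <> 0)%R by (apply not_0_INR; lia).
  replace ((INR (n + 1) - INR j) * PI / INR (n + 1))%R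
    with (PI - INR j * PI / INR (n + 1))%R by (field; auto).
  rewrite sin_PI_x, Rtrigo_facts.cos_pi_minus. unfold Rdiv; ring.
Qed.

Definition neck_form (n : nat) (z : C) : C :=
  / z - sum_n_m (fun i => RtoC (1 / INR n) / (z - (Ci + RtoC (cot_node n i)))) 1 n.

Lemma neck_form_opp (n : nat) (z : C) :
  neck_form n (- z)
  = sum_n_m (fun i => RtoC (1 / INR n) / (z + Ci - RtoC (cot_node n i))) 1 n - / z.
Proof.
  unfold neck_form. rewrite Cinv_opp, sum_n_m_rev.
  rewrite (sum_n_m_ext_loc _
    (fun i => - (RtoC (1 / INR n) / (z + Ci - RtoC (cot_node n i))))).
  - rewrite sum_n_m_opp. apply injective_projections; simpl; ring.
  - intros i Hi. rewrite cot_node_rev by lia. unfold Cdiv.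
    replace (- z - (Ci + RtoC (- cot_node n i)))
      with (- (z + Ci - RtoC (cot_node n i))) by (apply injective_projections; simpl; ring).
    rewrite Cinv_opp. eq_in_C. ring.
Qed.

Lemma neck_form_conj (n : nat) (z : C) :
  Cconj (neck_form n (Cconj z)) = - neck_form n (- z).
Proof.
  rewrite neck_form_opp. unfold neck_form.
  rewrite Cminus_conj, <- Cinv_conj_total, Cconj_conj, sum_n_m_conj.
  rewrite (sum_n_m_ext _ (fun i => RtoC (1 / INR n) / (z + Ci - RtoC (cot_node n i)))).
  - ring.
  - intro i. unfold Cdiv. rewrite Cmult_conj, <- Cinv_conj_total. f_equal.
    + apply injective_projections; simpl; ring.
    + f_equal. apply injective_projections; simpl; ring.
Qed.

Lemma meromorphic_neck_form_pow (n m : nat) :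
  meromorphic_at (fun z => neck_form n z ^ m) 0.
Proof.
  apply meromorphic_simple_pole_pow. intros i _ E.
  apply (f_equal snd) in E. simpl in E. lra.
Qed.

(** Two expansions of [w |-> conj (f (conj w)^(r+2))] at [0] are compared: the
    conjugate of that of [f^(r+2)], and the one given by
    [conj (f (conj w)) = - f (- w)]. *)
Lemma Res_neck_form_conj (n r : nat) :
  Cconj (Res (fun z => neck_form n z ^ (r + 2)) 0)
  = - (RtoC (-1) ^ r * Res (fun z => neck_form n z ^ (r + 2)) 0).
Proof.
  set (F := fun z => neck_form n z ^ (r + 2)).
  assert (HF : meromorphic_at F 0) by apply meromorphic_neck_form_pow.
  destruct HF as [a Ha]. rewrite (Res_laurent _ _ _ Ha).
  pose proof (is_laurent_conj _ _ _ Ha) as H1.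
  replace (Cconj 0) with (RtoC 0) in H1 by (apply injective_projections; simpl; ring).
  pose proof (is_laurent_scal _ _ (RtoC (-1) ^ r) _ (is_laurent_reflect F 0 0 a Ha)) as H2.
  apply (is_laurent_ext _ (fun z => Cconj (F (Cconj z)))) in H2.
  - rewrite (is_laurent_unique _ _ _ _ H1 H2 (-1)%Z).
    change (Z.abs_nat (-1)) with 1%nat. rewrite Cpow_1_r. ring.
  - intro z. unfold F. rewrite Cpow_conj, neck_form_conj.
    replace (0 + 0 - z) with (- z) by ring.
    replace (- neck_form n (- z)) with (RtoC (-1) * neck_form n (- z))
      by (apply injective_projections; simpl; ring).
    rewrite Cpow_mult_l, (Cpow_add_r (RtoC (-1))), (Cpow_m1_even 2) by (now exists 1%nat).
    ring.
Qed.

(** * Residues of the configuration *)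

Lemma periodic_shift (nk : Z -> nat) (p : Z -> nat -> C) (k0 : Z) (i N : nat) :
  (1 <= i <= N)%nat ->
  (forall m : Z, nk (k0 + 2 * m)%Z = N) ->
  (forall (k : Z) (i : nat), (1 <= i <= nk k)%nat -> p (k + 2)%Z i = p k i + 2 * Ci) ->
  forall m : Z, p (k0 + 2 * m)%Z i = p k0 i + RtoC (2 * IZR m) * Ci.
Proof.
  intros Hi HN Hper m.
  assert (Hstep : forall j, p (k0 + 2 * (j + 1))%Z i = p (k0 + 2 * j)%Z i + 2 * Ci).
  { intro j. rewrite <- Hper by (rewrite HN; exact Hi). f_equal. lia. }
  induction m as [|m IH|m IH] using Z.peano_ind.
  - rewrite Z.add_0_r. apply injective_projections; simpl; ring.
  - unfold Z.succ. rewrite Hstep, IH, plus_IZR. apply injective_projections; simpl; ring.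
  - specialize (Hstep (Z.pred m)). replace (Z.pred m + 1)%Z with m in Hstep by lia.
    rewrite IH in Hstep.
    replace (p (k0 + 2 * Z.pred m)%Z i) with (p k0 i + RtoC (2 * IZR m) * Ci - 2 * Ci).
    + unfold Z.pred. rewrite plus_IZR. apply injective_projections; simpl; ring.
    + rewrite Hstep. ring.
Qed.

(** [- z R - conj (z R)] is real: this is why the neck function vanishes. *)
Lemma Im_opp_mult_minus_conj (z R_ : C) :
  Im (z * - R_ - Cconj z * Cconj R_) = 0%R.
Proof. destruct z, R_; unfold Im; simpl; ring. Qed.

Theorem proposition3p1 (n : nat) (nk : Z -> nat) (p : Z -> nat -> C)
  (hn : (1 <= n)%nat)
  (hodd : forall k : Z, Z.Odd k -> nk k = n)
  (heven : forall k : Z, Z.Even k -> nk k = 1%nat)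
  (hp0 : p 0%Z 1%nat = 0)
  (hp1 : forall j : nat, (1 <= j <= n)%nat ->
     p 1%Z j = Ci + RtoC (cot (INR j * PI / INR (n + 1))))
  (hper : forall (k : Z) (i : nat), (1 <= i <= nk k)%nat ->
     p (k + 2)%Z i = p k i + 2 * Ci) :
  (forall r : nat, (1 <= r)%nat ->
     forall theta : R, Rneck nk p r 0 theta = 0%R) /\
  (forall k : Z, Z.Even k -> forall r : nat, (1 <= r)%nat ->
     forall theta : R, Rneck nk p r k theta = 0%R) /\
  (forall r : nat, (1 <= r)%nat ->
     let R_ := Res (fun z => omega_dz nk p 1 z ^ (r + 2)) 0 in
     (Nat.Even r -> Re R_ = 0%R) /\ (Nat.Odd r -> Im R_ = 0%R)).
Proof.
  assert (Hpe : forall m, p (2 * m)%Z 1%nat = RtoC (2 * IZR m) * Ci).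
  { intro m. change (2 * m)%Z with (0 + 2 * m)%Z.
    rewrite (periodic_shift nk p 0 1 1); [rewrite hp0; ring | lia | | exact hper].
    intro j. apply heven. now exists j. }
  assert (Hpo : forall m i, (1 <= i <= n)%nat ->
    p (2 * m + 1)%Z i = p (2 * m)%Z 1%nat + (Ci + RtoC (cot_node n i))).
  { intros m i Hi. rewrite Hpe, Z.add_comm.
    rewrite (periodic_shift nk p 1 i n);
      [rewrite hp1 by exact Hi; unfold cot_node; ring | lia | | exact hper].
    intro j. apply hodd. exists j. lia. }
  assert (Hnke : forall m, nk (2 * m)%Z = 1%nat) by (intro m; apply heven; now exists m).
  assert (Hnko : forall m, nk (2 * m + 1)%Z = n) by (intro m; apply hodd; now exists m).
  assert (Hup : forall m z, omega_dz nk p (2 * m + 1) z = neck_form n z).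
  { intros m z. unfold omega_dz, neck_form, c_.
    replace (2 * m + 1 - 1)%Z with (2 * m)%Z by lia.
    rewrite Hnke, Hnko, sum_n_n. f_equal.
    - replace (z - (p (2 * m)%Z 1%nat - p (2 * m)%Z 1%nat)) with z by ring.
      simpl INR. replace (1 / 1)%R with 1%R by field. unfold Cdiv. ring.
    - apply sum_n_m_ext_loc. intros i Hi. rewrite Hpo by lia.
      eq_in_C. f_equal. ring. }
  assert (Hdown : forall m z, omega_dz nk p (2 * m) z
    = neck_form n (0 + (p (2 * m)%Z 1%nat - p (2 * m - 1)%Z 1%nat) - z)).
  { intros m z. set (q := p (2 * m)%Z 1%nat - p (2 * m - 1)%Z 1%nat).
    replace (0 + q - z) with (- (z - q)) by ring. rewrite neck_form_opp.
    unfold omega_dz, c_. fold q.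
    assert (Em : (2 * m - 1 = 2 * (m - 1) + 1)%Z) by lia.
    assert (Hp : forall i, (1 <= i <= n)%nat ->
      p (2 * m - 1)%Z i = p (2 * m)%Z 1%nat - Ci + RtoC (cot_node n i)).
    { intros i Hi. rewrite Em, Hpo, !Hpe by exact Hi. rewrite minus_IZR.
      apply injective_projections; simpl; ring. }
    rewrite Hnke. replace (nk (2 * m - 1)%Z) with n by (now rewrite Em, Hnko).
    rewrite sum_n_n. f_equal.
    - apply sum_n_m_ext_loc. intros i Hi. eq_in_C. f_equal. unfold q.
      rewrite (Hp i) by lia. ring.
    - simpl INR. replace (1 / 1)%R with 1%R by field. unfold Cdiv. rewrite Cmult_1_l. reflexivity. }
  assert (HRup : forall m r, Res (fun z => omega_dz nk p (2 * m + 1) z ^ (r + 2)) 0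
     = Res (fun z => neck_form n z ^ (r + 2)) 0).
  { intros m r. destruct (meromorphic_neck_form_pow n (r + 2)) as [a Ha].
    rewrite (Res_laurent _ _ _ Ha). apply Res_laurent. revert Ha. apply is_laurent_ext.
    intro z. now rewrite Hup. }
  assert (HRdown : forall m r, Res (fun z => omega_dz nk p (2 * m) z ^ (r + 2))
       (p (2 * m)%Z 1%nat - p (2 * m - 1)%Z 1%nat)
     = - Res (fun z => neck_form n z ^ (r + 2)) 0).
  { intros m r. set (q := p (2 * m)%Z 1%nat - p (2 * m - 1)%Z 1%nat).
    pose proof (meromorphic_neck_form_pow n (r + 2)) as HF.
    rewrite <- (Res_reflect _ 0 q HF). destruct HF as [a Ha].
    apply (is_laurent_reflect _ 0 q) in Ha.
    rewrite (Res_laurent _ _ _ Ha).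
    apply (Res_laurent _ _ (fun j => RtoC (-1) ^ Z.abs_nat j * a j)).
    revert Ha. apply is_laurent_ext. intro z. now rewrite Hdown. }
  assert (Hall : forall m r theta, Rneck nk p r (2 * m) theta = 0%R).
  { intros m r theta. unfold Rneck. rewrite HRup, HRdown.
    replace (Cexpi (- (INR (r + 1) * theta))) with (Cconj (Cexpi (INR (r + 1) * theta))).
    - apply Im_opp_mult_minus_conj.
    - unfold Cexpi, Cconj. simpl. now rewrite cos_neg, sin_neg. }
  split; [|split].
  - intros r _ theta. exact (Hall 0%Z r theta).
  - intros k [m ->] r _ theta. apply Hall.
  - intros r _ R_.
    assert (HR : R_ = Res (fun z => neck_form n z ^ (r + 2)) 0) by exact (HRup 0%Z r).
    clearbody R_. pose proof (Res_neck_form_conj n r) as E. rewrite <- HR in E.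
    split; intro Hr.
    + rewrite Cpow_m1_even in E by exact Hr.
      apply (f_equal fst) in E. unfold Re. simpl in E. lra.
    + rewrite Cpow_m1_odd in E by exact Hr.
      apply (f_equal snd) in E. unfold Im. simpl in E. lra.
Qed.
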